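(* Let $M\ge 1$ and let $T'\ge M$ be an integer. Let $H_{11},H_{12},H_{21},H_{22}$ be mutually independent $M\times M$ random matrices whose entries are i.i.d. $\mathcal{CN}(0,1)$, and define $$V_{11}=\frac{H_{12}^{-1}}{\sqrt{\mathrm{tr}\left(H_{12}^{-1}H_{12}^{-H}\right)}},\qquad V_{21}=\frac{H_{22}^{-1}}{\sqrt{\mathrm{tr}\left(H_{22}^{-1}H_{22}^{-H}\right)}}.$$ Let $c_1,c_2>0$ and $\sigma^2>0$ be constants. Let $\mathcal{C}_1,\mathcal{C}_2$ be finite sets of $M\times T'$ complex matrices (codebooks) such that for every two distinct $A,A'\in\mathcal{C}_1$ the difference $A-A'$ has rank $M$, and for every two distinct $B,B'\in\mathcal{C}_2$ the difference $B-B'$ has rank $M$. For $P>0$ and distinct pairs $(A,B)\neq(A',B')$ in $\mathcal{C}_1\times\mathcal{C}_2$, define the average pairwise error probability $$P_e\big((A,B)\to(A',B')\big)=\mathbb{E}\left[Q\left(\sqrt{\frac{P\,\left\|\sqrt{c_1}\,H_{11}V_{11}(A-A')+\sqrt{c_2}\,H_{21}V_{21}(B-B')\right\|^2}{2\sigma^2}}\right)\right],$$ where the expectation is over the channel matrices. Then there exists a constant $c>0$, independent of $P$, such that $P_e\big((A,B)\to(A',B')\big)\le c\,P^{-M}$ for all sufficiently large $P$.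
   Context: $\mathcal{CN}(0,1)$ denotes the circularly symmetric complex Gaussian distribution with mean $0$ and variance $1$. $Q(x)=\frac{1}{\sqrt{2\pi}}\int_x^\infty e^{-t^2/2}\,dt$ is the Gaussian tail function. $\|\cdot\|$ is the Frobenius norm, $A^{-H}$ denotes the conjugate transpose of $A^{-1}$, and $\mathrm{tr}$ is the trace. This quantity is the pairwise error probability of maximum-likelihood decoding of $(A,B)$ from $Y=\sqrt{c_1P}H_{11}V_{11}A+\sqrt{c_2P}H_{21}V_{21}B+N$ with $N$ having i.i.d. $\mathcal{CN}(0,\sigma^2)$ entries. *)

(* Defs.v *)
From mathcomp Require Import all_boot all_order all_algebra.
From mathcomp Require Import all_classical all_reals all_analysis.
From mathcomp Require Import complex.
Set Implicit Arguments. Unset Strict Implicit. Unset Printing Implicit Defensive.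
Import Order.TTheory GRing.Theory Num.Theory.
Local Open Scope ring_scope.
Local Open Scope classical_set_scope.

Section Defs.
Variable R : realType.

(* Density of N(0,1/2): real and imaginary parts of a CN(0,1) variable. *)
Definition gdens (x : R) : R := (Num.sqrt pi)^-1 * expR (- x ^+ 2).

Definition vcons (x : R) (v : nat -> R) : nat -> R :=
  fun k => if k is k'.+1 then v k' else x.

(* gauss_expect n f = E[ f(X) ] where X_0, ..., X_{n-1} are i.i.d. N(0,1/2)
   (coordinates >= n are set to 0), written as the iterated Lebesgue
   integral against the product Gaussian density. *)
Fixpoint gauss_expect (n : nat) (f : (nat -> R) -> \bar R) : \bar R :=
  match n with
  | 0 => f (fun _ => 0)
  | n'.+1 => (\int[lebesgue_measure]_(x in [set: R])
               ((gdens x)%:E * gauss_expect n' (fun v => f (vcons x v))))%E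
  end.

Definition Qfun (x : R) : \bar R :=
  (((Num.sqrt (2 * pi))^-1)%:E *
   \int[lebesgue_measure]_(t in [set t : R | (x <= t)%R]) (expR (- t ^+ 2 / 2))%:E)%E.

Definition chan (M k : nat) (v : nat -> R) : 'M[R[i]]_M :=
  \matrix_(i < M, j < M)
    Complex (v (2 * M * M * k + 2 * (i * M + j))%N)
            (v (2 * M * M * k + 2 * (i * M + j) + 1)%N).

Definition ctr (m n : nat) (X : 'M[R[i]]_(m, n)) : 'M[R[i]]_(n, m) :=
  (map_mx conjc X)^T.

Definition rC (r : R) : R[i] := Complex r 0.

Definition frob2 (m n : nat) (X : 'M[R[i]]_(m, n)) : R :=
  \sum_(i < m) \sum_(j < n) (complex.Re (X i j) ^+ 2 + complex.Im (X i j) ^+ 2).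

Definition precoder (M : nat) (H : 'M[R[i]]_M) : 'M[R[i]]_M :=
  rC (Num.sqrt (complex.Re (\tr (invmx H *m ctr (invmx H)))))^-1 *: invmx H.

Definition pep (M T : nat) (c1 c2 s2 P : R) (A A' B B' : 'M[R[i]]_(M, T)) : \bar R :=
  gauss_expect (8 * M * M) (fun v =>
    let H11 := chan M 0 v in let H12 := chan M 1 v in
    let H21 := chan M 2 v in let H22 := chan M 3 v in
    let Y := rC (Num.sqrt c1) *: (H11 *m precoder H12 *m (A - A'))
           + rC (Num.sqrt c2) *: (H21 *m precoder H22 *m (B - B')) in
    Qfun (Num.sqrt (P * frob2 Y / (2 * s2)))).

End Defs.

(* Main.v *)
(* Since Q(x) <= exp(-x^2/2), it suffices to bound E[exp(-rho |Y|^2)] with rho = P/(4 sigma^2).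
   Say A <> A' (otherwise exchange the two transmitters). The precoder V11 has Frobenius norm 1
   unless H12 = 0, which is a null event, and A - A' has a right inverse; so some entry
   (j, t) of sqrt(c1) V11 (A - A') has squared modulus at least a constant delta > 0.
   Fix (j, t). The entry (r, t) of Y is kappa * H11(r, j) + s, where kappa is this large entry
   and s does not involve H11(r, j). The Gaussian density being bounded, integrating
   exp(-rho |kappa z + s|^2) over z = H11(r, j) gives at most 1 / (rho delta), whatever s is.
   Doing this for each of the M rows r yields (rho delta)^-M, and a sum over the finitely many
   pairs (j, t) concludes. As the integration order in [gauss_expect] is fixed, Tonelli's
   theorem is used to integrate a chosen coordinate first. *)

Require Import Defs.
From mathcomp Require Import all_boot all_order all_algebra.
From mathcomp Require Import all_classical all_reals all_analysis.
From mathcomp Require Import measurable_realfun complex ring lra zify.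
Set Implicit Arguments. Unset Strict Implicit. Unset Printing Implicit Defensive.
Import Order.TTheory GRing.Theory Num.Theory.
Local Open Scope ring_scope.

(** * Iterated Gaussian expectations: Tonelli, averaging one coordinate, linearity *)

Section GaussExpect.
Variable R : realType.
Local Notation mu := (@lebesgue_measure R).
Local Notation GR := (measurableTypeR R).
Implicit Types (f g : (nat -> R) -> \bar R) (v : nat -> R).

(* Measurability of functions of a sequence of coordinates, tested along every measurable
   family of coordinates instead of through a sigma-algebra on [nat -> R]. *)
Definition jmeas d (T : measurableType d) (F : T -> (nat -> R) -> \bar R) :=
  forall d' (T' : measurableType d') (a : T' -> T) (X : nat -> T' -> R),
    measurable_fun setT a -> (forall k, measurable_fun setT (X k)) ->
    measurable_fun setT (fun t => F (a t) (X ^~ t)).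

Definition smeas f :=
  forall d' (T' : measurableType d') (X : nat -> T' -> R),
    (forall k, measurable_fun setT (X k)) ->
    measurable_fun setT (fun t => f (X ^~ t)).

Lemma gdens_ge0 (x : R) : 0 <= gdens x.
Proof. by rewrite /gdens mulr_ge0 ?expR_ge0 ?invr_ge0 ?sqrtr_ge0. Qed.

Lemma measurable_gdens : measurable_fun [set: R] (@gdens R).
Proof.
apply: measurable_funM; first exact: measurable_cst.
by do 2 apply: measurableT_comp => //; exact: measurable_funX.
Qed.

Lemma integral_gdens : (\int[mu]_x (gdens x)%:E = 1)%E.
Proof.
rewrite -[RHS](@integral_normal_pdf R 0 (Num.sqrt 2)^-1).
apply: eq_integral => x _; congr EFin.
have s20 : Num.sqrt 2 != 0 :> R by rewrite sqrtr_eq0 -ltNge.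
rewrite normal_pdfE ?invr_eq0// /normal_peak /normal_fun /gdens.
rewrite subr0 exprVn sqr_sqrtr// -mulr_natr mulrAC mulVf ?mul1r//.
by rewrite -[2^-1 *+ 2]mulr_natr mulVf// divr1.
Qed.

(** The integral of a nonnegative function is a supremum over simple functions below it, so
    monotonicity asks for no measurability. This allows integrands such as the one in [pep] to be
    bounded directly. *)
Lemma le_integral_ge0 (f g : R -> \bar R) :
  (forall x, 0 <= f x)%E -> (forall x, f x <= g x)%E ->
  (\int[mu]_x f x <= \int[mu]_x g x)%E.
Proof.
move=> f0 fg; have g0 x : (0 <= g x)%E by exact: le_trans (fg x).
rewrite !ge0_integralTE//.
apply: ub_ereal_sup => _ /= [h hf <-]; apply: ereal_sup_ubound; exists h => // x.
exact: le_trans (hf x) _.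
Qed.

Lemma gauss_expect_ge0 n f : (forall v, 0 <= f v)%E -> (0 <= gauss_expect n f)%E.
Proof.
elim: n f => [|n IH] f f0 //=; apply: integral_ge0 => x _.
by rewrite mule_ge0 ?lee_fin ?gdens_ge0//; apply: IH.
Qed.

Lemma jmeas_vcons d (T : measurableType d) (F : T -> (nat -> R) -> \bar R) :
  jmeas F -> jmeas (fun (p : T * GR) v => F p.1 (vcons p.2 v)).
Proof.
move=> mF d' T' a X ma mX.
rewrite (_ : (fun t => _) = (fun t => F (a t).1
     ((fun k t => vcons (a t).2 (X ^~ t) k) ^~ t)))//.
apply: mF; first by apply: measurableT_comp => //; exact: measurable_fst.
by case=> [|k] /=; [apply: measurableT_comp => //; exact: measurable_snd|exact: mX].
Qed.

Lemma jmeas_smeas_vcons f : smeas f -> jmeas (fun x v => f (vcons x v)).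
Proof.
move=> mf d T a X ma mX; apply: (mf _ _ (fun k t => vcons (a t) (X ^~ t) k)).
by case=> [|k] /=; [exact: ma | exact: mX].
Qed.

(** Induction on [n] with the parameter space [T] varying: the head coordinate joins the parameter,
    and the partial integral of a nonnegative measurable function on [T * GR] is measurable by
    Tonelli. *)
Lemma measurable_gauss_expect n d (T : measurableType d)
    (F : T -> (nat -> R) -> \bar R) :
  jmeas F -> (forall t v, 0 <= F t v)%E ->
  measurable_fun setT (fun t => gauss_expect n (F t)).
Proof.
elim: n d T F => [|n IH] d T F mF F0 /=.
  by apply: (mF _ _ id (fun _ _ => 0)) => // k; exact: measurable_cst.
pose G (p : T * GR) := ((gdens p.2)%:E *
   gauss_expect n (fun v => F p.1 (vcons p.2 v)))%E.
apply: (@measurable_fun_fubini_tonelli_F _ _ T GR R mu G).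
- apply: emeasurable_funM.
    apply/measurable_EFinP; apply: measurableT_comp; first exact: measurable_gdens.
    exact: measurable_snd.
  by apply: (IH _ _ (fun p v => F p.1 (vcons p.2 v))) => //; exact: jmeas_vcons.
- by move=> p; rewrite /G mule_ge0 ?lee_fin ?gdens_ge0// gauss_expect_ge0.
Qed.

(** The extra variable [x] crosses the remaining coordinates by induction, then is exchanged with
    the head coordinate [y] by Tonelli on the plane. *)
Lemma gauss_expect_fubini n (F : R -> (nat -> R) -> \bar R) :
  jmeas F -> (forall t v, 0 <= F t v)%E ->
  gauss_expect n (fun v => \int[mu]_x ((gdens x)%:E * F x v))%E =
  (\int[mu]_x ((gdens x)%:E * gauss_expect n (F x)))%E.
Proof.
elim: n F => [|n IH] F mF F0 //=.
pose G (p : GR * GR) := gauss_expect n (fun v => F p.1 (vcons p.2 v)).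
have G0 p : (0 <= G p)%E by apply: gauss_expect_ge0.
have mG : measurable_fun setT G.
  apply: measurable_gauss_expect => //; exact: jmeas_vcons.
pose K (p : GR * GR) := ((gdens p.1)%:E * ((gdens p.2)%:E * G p))%E.
have K0 p : (0 <= K p)%E by rewrite !mule_ge0 ?lee_fin ?gdens_ge0.
have mg1 : measurable_fun setT (fun p : GR * GR => (gdens p.1)%:E).
  apply/measurable_EFinP; apply: measurableT_comp; first exact: measurable_gdens.
  exact: measurable_fst.
have mg2 : measurable_fun setT (fun p : GR * GR => (gdens p.2)%:E).
  apply/measurable_EFinP; apply: measurableT_comp; first exact: measurable_gdens.
  exact: measurable_snd.
have mK : measurable_fun setT K by apply: emeasurable_funM => //; exact: emeasurable_funM.
transitivity (\int[mu]_y \int[mu]_x K (x, y))%E.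
  apply: eq_integral => y _; rewrite IH; last 2 first.
  - move=> d' T' a X ma mX.
    by apply: (jmeas_vcons mF (a := fun t => (a t, y)) _ mX); exact/measurable_fun_pair.
  - by [].
  rewrite -ge0_integralZl.
  - by apply: eq_integral => x _; rewrite /K/= muleCA.
  - by [].
  - apply: emeasurable_funM; first by apply/measurable_EFinP; exact: measurable_gdens.
    exact: (measurableT_comp mG (measurable_pair2 y)).
  - by move=> x _; rewrite mule_ge0 ?lee_fin ?gdens_ge0// gauss_expect_ge0.
  - by rewrite lee_fin gdens_ge0.
rewrite -(@fubini_tonelli _ _ GR GR R mu mu K mK K0).
apply: eq_integral => x _; rewrite /K/= ge0_integralZl//.
- apply: emeasurable_funM; first by apply/measurable_EFinP; exact: measurable_gdens.
  exact: (measurableT_comp mG (measurable_pair1 x)).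
- by move=> y _; rewrite mule_ge0 ?lee_fin ?gdens_ge0.
- by rewrite lee_fin gdens_ge0.
Qed.

Definition upd (k : nat) (x : R) v : nat -> R := fun l => if l == k then x else v l.

(** The conditional expectation of [f] given all coordinates but the [k]-th; its value does not
    depend on [v k]. *)
Definition avg (k : nat) f v : \bar R := (\int[mu]_x ((gdens x)%:E * f (upd k x v)))%E.

Lemma avg_ge0 k f v : (forall v, 0 <= f v)%E -> (0 <= avg k f v)%E.
Proof.
by move=> f0; apply: integral_ge0 => x _; rewrite mule_ge0 ?lee_fin ?gdens_ge0.
Qed.

Lemma smeas_avg k f : (forall v, 0 <= f v)%E -> smeas f -> smeas (avg k f).
Proof.
move=> f0 mf d T X mX; rewrite /avg.
apply: (@measurable_fun_fubini_tonelli_F _ _ T GR R mu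
  (fun p => ((gdens p.2)%:E * f (upd k p.2 (X ^~ p.1)))%E)).
- apply: emeasurable_funM.
    apply/measurable_EFinP; apply: measurableT_comp; first exact: measurable_gdens.
    exact: measurable_snd.
  apply: (mf _ _ (fun l p => upd k p.2 (X ^~ p.1) l)) => l.
  rewrite /upd; case: (l == k); first exact: measurable_snd.
  by apply: measurableT_comp => //; exact: measurable_fst.
- by move=> p; rewrite mule_ge0 ?lee_fin ?gdens_ge0.
Qed.

Lemma smeas_vcons f (x : R) : smeas f -> smeas (fun v => f (vcons x v)).
Proof.
move=> mf d T X mX.
apply: (mf _ _ (fun k t => vcons x (X ^~ t) k)).
by case=> [|k] /=; [exact: measurable_cst | exact: mX].
Qed.

(** The tower property, which frees the proof from the fixed order of integration. For [k = 0] the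
    averaged function ignores the head, whose integral then has mass 1, and [gauss_expect_fubini]
    moves the inner integral outside. Larger [k] follow by induction under the head integral. *)
Lemma gauss_expect_avg n k f : (k < n)%N -> (forall v, 0 <= f v)%E -> smeas f ->
  gauss_expect n (avg k f) = gauss_expect n f.
Proof.
elim: n k f => [//|n IH] [|k] f kn f0 mf /=.
  pose h v := (\int[mu]_x ((gdens x)%:E * f (vcons x v)))%E.
  (* Averaging overwrites the head, so the value [y] disappears. *)
  have hE y : (fun v => avg 0 f (vcons y v)) = h.
    apply/funext => v; apply: eq_integral => x _.
    rewrite (_ : upd 0 x (vcons y v) = vcons x v)//.
    by apply/funext => -[|l] //; rewrite /upd /= ?eqSS.
  under eq_integral do rewrite hE.
  rewrite ge0_integralZr//; last 3 first.
  - by apply/measurable_EFinP; exact: measurable_gdens.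
  - by move=> y _; rewrite lee_fin gdens_ge0.
  - apply: gauss_expect_ge0 => v; apply: integral_ge0 => x _.
    by rewrite mule_ge0 ?lee_fin ?gdens_ge0.
  rewrite integral_gdens mul1e /h.
  apply: (@gauss_expect_fubini _ (fun x v => f (vcons x v))) => //.
  exact: jmeas_smeas_vcons.
apply: eq_integral => y _; congr (_ * _)%E.
rewrite -(IH k (fun v => f (vcons y v)))//; last exact: smeas_vcons.
congr gauss_expect; apply/funext => v; apply: eq_integral => x _.
rewrite (_ : upd k.+1 x (vcons y v) = vcons y (upd k x v))//.
by apply/funext => -[|l] //; rewrite /upd /= ?eqSS.
Qed.

Lemma gauss_expect_le n f g : (forall v, 0 <= f v)%E -> (forall v, f v <= g v)%E ->
  (gauss_expect n f <= gauss_expect n g)%E.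
Proof.
elim: n f g => [|n IH] f g f0 fg /=; first exact: fg.
apply: le_integral_ge0 => x.
  by rewrite mule_ge0 ?lee_fin ?gdens_ge0// gauss_expect_ge0.
rewrite lee_wpmul2l ?lee_fin ?gdens_ge0//.
exact: IH.
Qed.

Lemma gauss_expect_const n (c : R) : 0 <= c -> gauss_expect n (fun=> c%:E) = c%:E.
Proof.
move=> c0; elim: n => [//|n IH] /=; under eq_integral do rewrite IH.
rewrite ge0_integralZr//; last 2 first.
- by apply/measurable_EFinP; exact: measurable_gdens.
- by move=> y _; rewrite lee_fin gdens_ge0.
by rewrite integral_gdens mul1e.
Qed.

Lemma gauss_expectD n f g : smeas f -> smeas g ->
  (forall v, 0 <= f v)%E -> (forall v, 0 <= g v)%E ->
  gauss_expect n (fun v => f v + g v)%E = (gauss_expect n f + gauss_expect n g)%E.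
Proof.
have mE h m : smeas h -> (forall v, 0 <= h v)%E ->
    measurable_fun setT (fun x : R => gauss_expect m (fun v => h (vcons x v))).
  move=> mh h0; apply: (@measurable_gauss_expect m _ _ (fun x v => h (vcons x v))) => //.
  exact: jmeas_smeas_vcons.
elim: n f g => [//|n IH] f g mf mg f0 g0 /=.
rewrite -ge0_integralD//.
- apply: eq_integral => x _; rewrite IH//; try exact: smeas_vcons.
  by rewrite ge0_muleDr// gauss_expect_ge0.
- by move=> x _; rewrite mule_ge0 ?lee_fin ?gdens_ge0// gauss_expect_ge0.
- apply: emeasurable_funM; first by apply/measurable_EFinP; exact: measurable_gdens.
  exact: mE.
- by move=> x _; rewrite mule_ge0 ?lee_fin ?gdens_ge0// gauss_expect_ge0.
- apply: emeasurable_funM; first by apply/measurable_EFinP; exact: measurable_gdens.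
  exact: mE.
Qed.

Lemma gauss_expect_le_avg n k f g : (k < n)%N -> smeas f -> (forall v, 0 <= f v)%E ->
  (forall v, avg k f v <= g v)%E -> (gauss_expect n f <= gauss_expect n g)%E.
Proof.
move=> kn mf f0 fg; rewrite -(gauss_expect_avg kn f0 mf).
by apply: gauss_expect_le => // v; exact: avg_ge0.
Qed.

Lemma gauss_expect_sum n (I : Type) (s : seq I) (f : I -> (nat -> R) -> \bar R) :
  (forall i, smeas (f i)) -> (forall i v, 0 <= f i v)%E ->
  gauss_expect n (fun v => \sum_(i <- s) f i v)%E =
  (\sum_(i <- s) gauss_expect n (f i))%E.
Proof.
move=> mf f0; elim: s => [|i s IH].
  rewrite big_nil; under eq_fun do rewrite big_nil.
  exact: (gauss_expect_const n (lexx 0)).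
rewrite big_cons -IH -gauss_expectD//.
- by under eq_fun do rewrite big_cons.
- move=> d U X mX; apply: emeasurable_sum => j; exact: mf.
- by move=> v; exact: sume_ge0.
Qed.

End GaussExpect.

(** * Measurability of complex and matrix operations, up to the precoder *)

Section ComplexMeasurability.
Variables (R : realType) (d : measure_display) (T : measurableType d).

Lemma eq1_measurable_fun d' (U : measurableType d') (f g : T -> U) :
  f =1 g -> measurable_fun setT g -> measurable_fun setT f.
Proof. by move=> /funext ->. Qed.

Lemma measurable_natr_bool (b : T -> bool) :
  measurable_fun setT b -> measurable_fun setT (fun t => (b t)%:R : R).
Proof.
move=> mb; rewrite (_ : (fun t => _) = fun t => if b t then 1 else 0); last first.
  by apply/funext => t; case: (b t).
by apply: measurable_fun_ifT => //; exact: measurable_cst.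
Qed.

Definition cmeas (F : T -> R[i]) :=
  measurable_fun setT (fun t => complex.Re (F t)) /\
  measurable_fun setT (fun t => complex.Im (F t)).

Definition mxmeas m n (F : T -> 'M[R[i]]_(m, n)) := forall i j, cmeas (fun t => F t i j).

Lemma Re_mulc (x y : R[i]) :
  complex.Re (x * y) = complex.Re x * complex.Re y - complex.Im x * complex.Im y.
Proof. by case: x y => [a b] []. Qed.

Lemma Im_mulc (x y : R[i]) :
  complex.Im (x * y) = complex.Re x * complex.Im y + complex.Im x * complex.Re y.
Proof. by case: x y => [a b] []. Qed.

Lemma Re_addc (x y : R[i]) : complex.Re (x + y) = complex.Re x + complex.Re y.
Proof. by case: x y => [a b] []. Qed.

Lemma Im_addc (x y : R[i]) : complex.Im (x + y) = complex.Im x + complex.Im y.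
Proof. by case: x y => [a b] []. Qed.

Lemma cmeas_cst (z : R[i]) : cmeas (fun=> z).
Proof. by split; exact: measurable_cst. Qed.

Lemma cmeasD F G : cmeas F -> cmeas G -> cmeas (fun t => F t + G t).
Proof.
move=> [F1 F2] [G1 G2]; split.
- by apply: (eq1_measurable_fun (fun t => Re_addc _ _)); exact: measurable_funD.
- by apply: (eq1_measurable_fun (fun t => Im_addc _ _)); exact: measurable_funD.
Qed.

Lemma cmeasM F G : cmeas F -> cmeas G -> cmeas (fun t => F t * G t).
Proof.
move=> [F1 F2] [G1 G2]; split.
- by apply: (eq1_measurable_fun (fun t => Re_mulc _ _)); apply: measurable_funB; exact: measurable_funM.
- by apply: (eq1_measurable_fun (fun t => Im_mulc _ _)); apply: measurable_funD; exact: measurable_funM.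
Qed.

Lemma measurable_fun_ge0V (f : T -> R) : (forall t, 0 <= f t) ->
  measurable_fun setT f -> measurable_fun setT (fun t => (f t)^-1).
Proof.
move=> f0 mf; apply: (@eq1_measurable_fun _ _ _ (fun t => f t `^ (-1))).
  by move=> t; rewrite powR_inv1.
by apply: (@measurableT_comp _ _ _ _ _ _ (fun x : R => x `^ (-1))) => //; exact: measurable_powR.
Qed.

Lemma cmeasV F : cmeas F -> cmeas (fun t => (F t)^-1).
Proof.
move=> [F1 F2].
(* The formula also covers [z = 0], since both sides are then 0 by the convention on inverses. *)
have E (z : R[i]) : z^-1 = Complex
    (complex.Re z * (complex.Re z ^+ 2 + complex.Im z ^+ 2)^-1)
    (- (complex.Im z * (complex.Re z ^+ 2 + complex.Im z ^+ 2)^-1)) by case: z.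
have mV : measurable_fun setT
    (fun t => (complex.Re (F t) ^+ 2 + complex.Im (F t) ^+ 2)^-1).
  apply: measurable_fun_ge0V; first by move=> t; rewrite addr_ge0 ?sqr_ge0.
  by apply: measurable_funD; exact: measurable_funX.
have -> : (fun t => (F t)^-1) = (fun t => Complex
    (complex.Re (F t) * (complex.Re (F t) ^+ 2 + complex.Im (F t) ^+ 2)^-1)
    (- (complex.Im (F t) * (complex.Re (F t) ^+ 2 + complex.Im (F t) ^+ 2)^-1))).
  by apply/funext => t; rewrite E.
split => /=; first exact: measurable_funM.
by apply: measurable_funN; exact: measurable_funM.
Qed.

Lemma cmeas_sum (I : Type) (s : seq I) (P : pred I) (F : I -> T -> R[i]) :
  (forall i, cmeas (F i)) -> cmeas (fun t => \sum_(i <- s | P i) F i t).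
Proof.
move=> mF; elim: s => [|i s IH].
  by under eq_fun do rewrite big_nil; exact: cmeas_cst.
under eq_fun do rewrite big_cons; case: (P i) => //; exact: cmeasD.
Qed.

Lemma cmeas_prod (I : Type) (s : seq I) (P : pred I) (F : I -> T -> R[i]) :
  (forall i, cmeas (F i)) -> cmeas (fun t => \prod_(i <- s | P i) F i t).
Proof.
move=> mF; elim: s => [|i s IH].
  by under eq_fun do rewrite big_nil; exact: cmeas_cst.
under eq_fun do rewrite big_cons; case: (P i) => //; exact: cmeasM.
Qed.

Lemma cmeas_if (b : T -> bool) F G : measurable_fun setT b -> cmeas F -> cmeas G ->
  cmeas (fun t => if b t then F t else G t).
Proof.
move=> mb [F1 F2] [G1 G2]; split.
- rewrite (_ : (fun t => _) = fun t => if b t then complex.Re (F t) else complex.Re (G t)).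
    exact: measurable_fun_ifT.
  by apply/funext => t; case: (b t).
- rewrite (_ : (fun t => _) = fun t => if b t then complex.Im (F t) else complex.Im (G t)).
    exact: measurable_fun_ifT.
  by apply/funext => t; case: (b t).
Qed.

Lemma measurable_cneq0 F : cmeas F -> measurable_fun setT (fun t => F t != 0).
Proof.
move=> [F1 F2].
have E t : (F t != 0) = ~~ ((complex.Re (F t) == 0) && (complex.Im (F t) == 0)).
  by rewrite eq_complex.
apply: (eq1_measurable_fun E).
apply: measurable_neg; apply: measurable_and; apply: measurable_fun_eqr => //.
Qed.

Lemma mxmeas_cst m n (A : 'M[R[i]]_(m, n)) : mxmeas (fun=> A).
Proof. by move=> i j; exact: cmeas_cst. Qed.

Lemma mxmeasD m n (F G : T -> 'M[R[i]]_(m, n)) :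
  mxmeas F -> mxmeas G -> mxmeas (fun t => F t + G t).
Proof. by move=> mF mG i j; under eq_fun do rewrite mxE; exact: cmeasD. Qed.

Lemma mxmeasZ m n f (F : T -> 'M[R[i]]_(m, n)) :
  cmeas f -> mxmeas F -> mxmeas (fun t => f t *: F t).
Proof. by move=> mf mF i j; under eq_fun do rewrite mxE; exact: cmeasM. Qed.

Lemma mxmeasM m n p (F : T -> 'M[R[i]]_(m, n)) (G : T -> 'M[R[i]]_(n, p)) :
  mxmeas F -> mxmeas G -> mxmeas (fun t => F t *m G t).
Proof.
move=> mF mG i j; under eq_fun do rewrite mxE.
by apply: cmeas_sum => k; exact: cmeasM.
Qed.

Lemma cmeas_det n (F : T -> 'M[R[i]]_n) : mxmeas F -> cmeas (fun t => \det (F t)).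
Proof.
move=> mF; rewrite /determinant; apply: cmeas_sum => s.
by apply: cmeasM; [exact: cmeas_cst | apply: cmeas_prod => i; exact: mF].
Qed.

Lemma mxmeas_invmx n (F : T -> 'M[R[i]]_n) : mxmeas F -> mxmeas (fun t => invmx (F t)).
Proof.
move=> mF i j.
(* Cramer's rule where the determinant is nonzero; on singular matrices [invmx] returns its
   argument. *)
have E t : invmx (F t) i j =
    if \det (F t) != 0 then (\det (F t))^-1 * cofactor (F t) j i else F t i j.
  rewrite /invmx unitmxE unitfE; case: ifP => // _.
  by rewrite !mxE.
under eq_fun do rewrite E.
apply: cmeas_if; [exact/measurable_cneq0/cmeas_det| |exact: mF].
apply: cmeasM; first exact/cmeasV/cmeas_det.
apply: cmeasM; first exact: cmeas_cst.
by apply: cmeas_det => a b; under eq_fun do rewrite !mxE; exact: mF.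
Qed.

Lemma measurable_sqrt (f : T -> R) :
  measurable_fun setT f -> measurable_fun setT (fun t => Num.sqrt (f t)).
Proof.
move=> mf; apply: (measurableT_comp _ mf).
by apply: continuous_measurable_fun => x; exact: sqrt_continuous.
Qed.

Lemma mxmeas_precoder n (F : T -> 'M[R[i]]_n) :
  mxmeas F -> mxmeas (fun t => precoder (F t)).
Proof.
move=> mF; rewrite /precoder; apply: mxmeasZ; last exact: mxmeas_invmx.
split; last exact: measurable_cst.
apply: measurable_fun_ge0V; first by move=> t; exact: sqrtr_ge0.
apply: measurable_sqrt.
suff [] : cmeas (fun t => \tr (invmx (F t) *m ctr (invmx (F t)))) by [].
rewrite /mxtrace; apply: cmeas_sum => i.
apply: mxmeasM; first exact: mxmeas_invmx.
move=> a b; under eq_fun do rewrite !mxE.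
have [I1 I2] := mxmeas_invmx mF b a.
have E (z : R[i]) : conjc z = Complex (complex.Re z) (- complex.Im z) by case: z.
under eq_fun do rewrite E; split => //; exact: measurable_funN.
Qed.

Definition csq (z : R[i]) : R := complex.Re z ^+ 2 + complex.Im z ^+ 2.

Lemma measurable_csq F : cmeas F -> measurable_fun setT (fun t => csq (F t)).
Proof. by move=> [F1 F2]; apply: measurable_funD; exact: measurable_funX. Qed.

End ComplexMeasurability.

(** * Gaussian tail and integral estimates *)

Section Bounds.
Variable R : realType.
Local Notation mu := (@lebesgue_measure R).
Implicit Types (f g : (nat -> R) -> \bar R) (v : nat -> R).

Lemma integral_scaled_normal (c m s : R) : 0 <= c ->
  (\int[mu]_x (c * normal_pdf m s x)%:E = c%:E)%E.
Proof.
move=> c0; under eq_integral do rewrite EFinM.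
rewrite ge0_integralZl// ?integral_normal_pdf ?mule1//.
- by apply/measurable_EFinP; exact: measurable_normal_pdf.
- by move=> x _; rewrite lee_fin normal_pdf_ge0.
Qed.

(** For [0 <= x <= t] one has [t^2 >= x^2 + (t - x)^2]. The integrand is thus at most
    [expR (- x ^+ 2 / 2)] times an unnormalised Gaussian centred at [x], which is then integrated
    over the whole line. *)
Lemma Qfun_le (x : R) : 0 <= x -> (Qfun x <= (expR (- x ^+ 2 / 2))%:E)%E.
Proof.
move=> x0; rewrite /Qfun.
have p0 : 0 < 2 * pi :> R by rewrite mulr_gt0 ?pi_gt0.
have s0 : 0 < Num.sqrt (2 * pi) :> R by rewrite sqrtr_gt0.
rewrite integral_mkcond.
apply: (@le_trans _ _ (((Num.sqrt (2 * pi))^-1)%:E *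
   \int[mu]_t (Num.sqrt (2 * pi) * expR (- x ^+ 2 / 2) * normal_pdf x 1 t)%:E)%E).
  rewrite lee_wpmul2l ?lee_fin ?invr_ge0 ?sqrtr_ge0//.
  apply: le_integral_ge0 => t.
    by rewrite /patch; case: ifP => // _; rewrite lee_fin expR_ge0.
  rewrite normal_pdfE ?oner_eq0// /normal_peak /normal_fun.
  rewrite /patch; case: ifPn => [|_]; last first.
    by rewrite lee_fin !mulr_ge0 ?expR_ge0 ?invr_ge0 ?sqrtr_ge0.
  rewrite inE /= => xt; rewrite lee_fin.
  have -> : 1 ^+ 2 * pi *+ 2 = 2 * pi :> R by ring.
  have -> : forall a b c : R, a * b * (a^-1 * c) = a / a * (b * c) by move=> *; ring.
  rewrite divff ?gt_eqF// mul1r -expRD ler_expR; nra.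
rewrite integral_scaled_normal ?mulr_ge0 ?expR_ge0 ?sqrtr_ge0//.
by rewrite -EFinM mulrA mulVf ?mul1r// gt_eqF.
Qed.

(** Bounding [gdens] by its maximum [1 / sqrt pi] leaves a Gaussian integral equal to
    [sqrt (pi / l)]; the bound is therefore uniform in the shift [a]. *)
Lemma gdens_gauss (l a : R) : 0 < l ->
  (\int[mu]_x ((gdens x)%:E * (expR (- (l * (x + a) ^+ 2)))%:E) <=
   ((Num.sqrt l)^-1)%:E)%E.
Proof.
move=> l0; have sl0 : 0 < Num.sqrt l by rewrite sqrtr_gt0.
have p0 : 0 < pi :> R by exact: pi_gt0.
have spi0 : 0 < Num.sqrt pi :> R by rewrite sqrtr_gt0.
(* [s] is the standard deviation for which [expR (- (l * (x + a) ^+ 2))] is proportional to a normal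
   density. *)
have [s [sn0 s2]] : exists s : R, s != 0 /\ s ^+ 2 * 2 = l^-1.
  exists (Num.sqrt (l * 2))^-1.
  rewrite invr_eq0 sqrtr_eq0 -ltNge mulr_gt0//; split => //.
  by rewrite exprVn sqr_sqrtr ?mulr_ge0 ?ltW// invfM -mulrA mulVf ?mulr1.
rewrite -[leRHS](@integral_scaled_normal _ (- a) s); last by rewrite invr_ge0 ltW.
apply: le_integral_ge0 => x.
  by rewrite mule_ge0 ?lee_fin ?gdens_ge0 ?expR_ge0.
rewrite -EFinM lee_fin normal_pdfE// /normal_peak /normal_fun /gdens opprK.
have -> : s ^+ 2 * pi *+ 2 = pi / l by rewrite -s2; ring.
have -> : s ^+ 2 *+ 2 = l^-1 by rewrite -s2; ring.
rewrite invrK (sqrtrM _ (ltW p0)) (sqrtrV (ltW l0)) invfM invrK.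
have -> : forall b c : R, (Num.sqrt l)^-1 * (b * Num.sqrt l * c) =
   (Num.sqrt l)^-1 * Num.sqrt l * b * c by move=> *; ring.
rewrite mulVf ?gt_eqF// mul1r -mulrA ler_wpM2l ?invr_ge0 ?sqrtr_ge0//.
rewrite mulNr mulrC [_ * l]mulrC ler_piMr ?expR_ge0//.
by rewrite -expR0 ler_expR oppr_le0 sqr_ge0.
Qed.

Lemma measurable_gauss_fun (l a : R) :
  measurable_fun [set: R] (fun x => (expR (- (l * (x + a) ^+ 2)))%:E).
Proof.
apply/measurable_EFinP; apply: measurableT_comp => //; apply: measurableT_comp => //.
by apply: measurable_funM => //; apply: measurable_funX; exact: measurable_funD.
Qed.

(* Complete the square: csq (K z + S) = csq K |z + S / K|^2 separates the two real
   coordinates of z. *)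
Lemma gdens_complex (rho c : R) (K S : R[i]) : 0 <= c -> 0 < rho -> 0 < csq K ->
  (\int[mu]_x ((gdens x)%:E * \int[mu]_y ((gdens y)%:E *
     (c * expR (- (rho * csq (K * Complex x y + S))))%:E)) <=
   (c / (rho * csq K))%:E)%E.
Proof.
move=> c0 r0 K0; set l := rho * csq K.
have l0 : 0 < l by rewrite mulr_gt0.
pose z := S / K; have Kn0 : K != 0.
  by apply: contraTneq K0 => ->; rewrite /csq /= expr0n addr0 ltxx.
have E x y : expR (- (rho * csq (K * Complex x y + S))) =
    expR (- (l * (x + complex.Re z) ^+ 2)) * expR (- (l * (y + complex.Im z) ^+ 2)).
  rewrite -expRD -opprD -mulrDr /l -mulrA; congr (expR (- (_ * _))).
  have -> : S = K * z by rewrite /z mulrC divfK.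
  rewrite -mulrDr; case: z => a b.
  rewrite /csq Re_mulc Im_mulc /=; ring.
apply: (@le_trans _ _ (\int[mu]_x ((c / Num.sqrt l)%:E * ((gdens x)%:E *
   (expR (- (l * (x + complex.Re z) ^+ 2)))%:E)))%E).
  apply: le_integral_ge0 => x.
    rewrite mule_ge0 ?lee_fin ?gdens_ge0// integral_ge0// => y _.
    by rewrite mule_ge0 ?lee_fin ?gdens_ge0// mulr_ge0 ?expR_ge0.
  rewrite muleCA lee_wpmul2l ?lee_fin ?gdens_ge0//.
  under eq_integral => y _ do rewrite E mulrA (EFinM (c * _)) muleCA.
  rewrite ge0_integralZl//; last 3 first.
  - apply: emeasurable_funM; last exact: measurable_gauss_fun.
    by apply/measurable_EFinP; exact: measurable_gdens.
  - by move=> y _; rewrite mule_ge0 ?lee_fin ?gdens_ge0 ?expR_ge0.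
  - by rewrite lee_fin mulr_ge0 ?expR_ge0.
  apply: (le_trans (lee_wpmul2l _ (gdens_gauss _ l0))).
    by rewrite lee_fin mulr_ge0 ?expR_ge0.
  by rewrite -!EFinM mulrAC lee_fin.
rewrite ge0_integralZl//; last 3 first.
- apply: emeasurable_funM; last exact: measurable_gauss_fun.
  by apply/measurable_EFinP; exact: measurable_gdens.
- by move=> y _; rewrite mule_ge0 ?lee_fin ?gdens_ge0 ?expR_ge0.
- by rewrite lee_fin mulr_ge0 ?invr_ge0 ?sqrtr_ge0.
apply: (le_trans (lee_wpmul2l _ (gdens_gauss _ l0))).
  by rewrite lee_fin mulr_ge0 ?invr_ge0 ?sqrtr_ge0.
by rewrite -EFinM lee_fin -mulrA -invfM -expr2 sqr_sqrtr ?(ltW l0).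
Qed.

(** One complex channel entry, stored at [k] and [k.+1], is integrated out while all else is frozen.
    The weight [c] will carry both the indicator that [K] is large and the factors of the rows still
    to be treated. *)
Lemma gauss_expect_row n k (rho delta : R) (c : (nat -> R) -> R) (K S : (nat -> R) -> R[i]) :
  (k.+1 < n)%N -> 0 < rho -> 0 < delta ->
  (forall v, 0 <= c v) -> (forall v, c v != 0 -> delta <= csq (K v)) ->
  (forall v x, c (upd k x v) = c v) -> (forall v x, c (upd k.+1 x v) = c v) ->
  (forall v x, K (upd k x v) = K v) -> (forall v x, K (upd k.+1 x v) = K v) ->
  (forall v x, S (upd k x v) = S v) -> (forall v x, S (upd k.+1 x v) = S v) ->
  let f v := (c v * expR (- (rho * csq (K v * Complex (v k) (v k.+1) + S v))))%:E in
  smeas f ->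
  (gauss_expect n f <= gauss_expect n (fun v => (c v / (rho * delta))%:E))%E.
Proof.
move=> kn r0 d0 c0 cK c1 c2 K1 K2 S1 S2 f mf.
have f0 v : (0 <= f v)%E by rewrite lee_fin mulr_ge0 ?expR_ge0.
have fa0 v : (0 <= avg k.+1 f v)%E by exact: avg_ge0.
(* The imaginary part is averaged first, then the real part, to match the nesting in
   [gdens_complex]. *)
rewrite -(gauss_expect_avg kn f0 mf).
apply: (@gauss_expect_le_avg _ n k (avg k.+1 f) _ (ltnW kn) (smeas_avg k.+1 f0 mf) fa0) => v.
rewrite /avg /f.
under eq_integral => x _.
  under eq_integral => y _.
    rewrite c2 c1 K2 K1 S2 S1 (_ : upd k.+1 y (upd k x v) k = x); last first.
      by rewrite /upd eqxx ltn_eqF.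
    rewrite (_ : upd k.+1 y (upd k x v) k.+1 = y); last by rewrite /upd eqxx.
    over.
  over.
(* Where the weight vanishes [K] has no lower bound, but both sides are 0. *)
have [cv0|cv0] := eqVneq (c v) 0.
  rewrite cv0 mul0r integral0_eq// => x _; rewrite integral0_eq ?mule0// => y _.
  by rewrite mul0r mule0.
have dK := cK v cv0; have K0 : 0 < csq (K v) by exact: lt_le_trans dK.
apply: (le_trans (gdens_complex _ (c0 v) r0 K0)).
by rewrite lee_fin ler_wpM2l// lef_pV2 ?posrE ?mulr_gt0// ler_pM2l.
Qed.

Lemma smeas_eq0 k : smeas (fun v : nat -> R => ((v k == 0)%:R)%:E).
Proof.
move=> d T X mX; apply/measurable_EFinP; apply: measurable_natr_bool.
by apply: measurable_fun_eqr => //; exact: measurable_cst.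
Qed.

(** Averaging coordinate [k] first reduces the claim to the Lebesgue measure of a single point. *)
Lemma gauss_expect_eq0 n k : (k < n)%N ->
  gauss_expect n (fun v : nat -> R => ((v k == 0)%:R)%:E) = 0%E.
Proof.
move=> kn; pose f (v : nat -> R) : \bar R := ((v k == 0)%:R)%:E.
have f0 v : (0 <= f v)%E by rewrite lee_fin ler0n.
have mf : smeas f by exact: smeas_eq0.
rewrite -(gauss_expect_avg kn f0 mf).
rewrite (_ : avg k f = fun=> 0%:E); first by rewrite gauss_expect_const.
apply/funext => v; rewrite /avg /f.
transitivity (\int[mu]_x ((gdens 0)%:E * (\1_[set 0] x)%:E))%E.
  apply: eq_integral => x _; rewrite /upd eqxx indicE.
  have [->|x0] := eqVneq x 0; first by rewrite mem_set.
  by rewrite memNset ?mule0// => /eqP; exact/negP.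
rewrite ge0_integralZl//.
- by rewrite integral_indic//= setIT lebesgue_measure_set1 mule0.
- by apply/measurable_EFinP; exact: measurable_indic.
- by rewrite lee_fin gdens_ge0.
Qed.
End Bounds.

(** * Squared moduli, Frobenius norm and normalisation of the precoder *)

Section FrobeniusNorm.
Variable R : realType.
Implicit Types (z w : R[i]).

Lemma csq_ge0 z : 0 <= csq z. Proof. by rewrite addr_ge0 ?sqr_ge0. Qed.

Lemma csqM z w : csq (z * w) = csq z * csq w.
Proof. rewrite /csq Re_mulc Im_mulc; ring. Qed.

Lemma csq_rC (r : R) : csq (rC r) = r ^+ 2.
Proof. by rewrite /csq /= expr0n addr0. Qed.

Lemma csq_eq0 z : (csq z == 0) = (z == 0).
Proof. by rewrite eq_complex /csq paddr_eq0 ?sqr_ge0// !sqrf_eq0. Qed.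

(** Iterates [|z + w|^2 <= 2 |z|^2 + 2 |w|^2]. The constant is crude, but only its independence of
    [z] matters. *)
Lemma csq_sum n (z : 'I_n -> R[i]) :
  csq (\sum_(i < n) z i) <= 2 ^+ n * \sum_(i < n) csq (z i).
Proof.
elim: n z => [|n IH] z.
  by rewrite !big_ord0 mulr0 /csq /= expr0n addr0.
rewrite !big_ord_recl /=; set w := \sum_(i < n) _; set s := \sum_(i < n) _.
have ws : csq w <= 2 ^+ n * s by exact: IH.
have D : csq (z ord0 + w) <= 2 * csq (z ord0) + 2 * csq w.
  rewrite /csq Re_addc Im_addc.
  have := sqr_ge0 (complex.Re (z ord0) - complex.Re w).
  have := sqr_ge0 (complex.Im (z ord0) - complex.Im w); nra.
have p1 : 1 <= 2 ^+ n :> R by rewrite exprn_ege1// ler1n.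
apply: (le_trans D); rewrite exprS -mulrA -mulrDr ler_pM2l// mulrDr lerD//.
by rewrite ler_peMl ?csq_ge0.
Qed.

Lemma frob2E m n (X : 'M[R[i]]_(m, n)) : frob2 X = \sum_(i < m) \sum_(j < n) csq (X i j).
Proof. by []. Qed.

Lemma frob2_ge0 m n (X : 'M[R[i]]_(m, n)) : 0 <= frob2 X.
Proof. by rewrite frob2E; do 2 apply: sumr_ge0 => ? _; exact: csq_ge0. Qed.

Lemma frob2_eq0 m n (X : 'M[R[i]]_(m, n)) : frob2 X = 0 -> X = 0.
Proof.
move=> X0; apply/matrixP => i j; rewrite mxE; apply/eqP; rewrite -csq_eq0.
have ge i' : true -> 0 <= \sum_(j < n) csq (X i' j).
  by move=> _; apply: sumr_ge0 => ? _; exact: csq_ge0.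
have /(psumr_eq0P ge)/(_ i isT) := X0.
by move=> /(psumr_eq0P (fun j _ => csq_ge0 _))/(_ j isT)/eqP.
Qed.

Lemma frob2Z m n (r : R) (X : 'M[R[i]]_(m, n)) : frob2 (rC r *: X) = r ^+ 2 * frob2 X.
Proof.
rewrite !frob2E mulr_sumr; apply: eq_bigr => i _; rewrite mulr_sumr.
by apply: eq_bigr => j _; rewrite mxE csqM csq_rC.
Qed.

(** The trace under the root is the squared Frobenius norm of [invmx H]. It is positive even for
    singular nonzero [H], since [invmx H] is then [H] itself; the exceptional event thus shrinks to
    [H = 0]. *)
Lemma frob2_precoder M (H : 'M[R[i]]_M) : H != 0 -> frob2 (precoder H) = 1.
Proof.
move=> H0; rewrite /precoder frob2Z.
have X0 : invmx H != 0.
  apply: contra H0 => /eqP E; have [uH|nuH] := boolP (H \in unitmx).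
    by rewrite -[H]mulmx1 -(mulmxV uH) E !mulmx0.
  by rewrite -E invmx_out.
have -> : complex.Re (\tr (invmx H *m ctr (invmx H))) = frob2 (invmx H).
  rewrite /mxtrace (raddf_sum (@complex.Re R : Rcomplex R -> R)) frob2E.
  apply: eq_bigr => i _; rewrite mxE.
  rewrite (raddf_sum (@complex.Re R : Rcomplex R -> R)).
  apply: eq_bigr => j _; rewrite !mxE; case: (invmx H i j) => a b.
  rewrite [LHS]/= /csq /=; ring.
have f0 : 0 < frob2 (invmx H).
  rewrite lt_def frob2_ge0 andbT; apply: contra X0 => /eqP; move/frob2_eq0 => ->.
  exact: eqxx.
by rewrite exprVn sqr_sqrtr ?ltW// mulVf// gt_eqF.
Qed.

(* [V] is recovered from [V *m D] through a right inverse of [D], so the entries of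
   [V *m D] cannot all be small. *)
Lemma row_free_entry_lower M T (D : 'M[R[i]]_(M, T)) : \rank D = M ->
  exists2 delta : R, 0 < delta & forall V : 'M[R[i]]_M, frob2 V = 1 ->
    exists j t, delta <= csq ((V *m D) j t).
Proof.
move=> rD; have DW : D *m pinvmx D = 1%:M by rewrite mulmxVp// /row_free rD.
set W := pinvmx D in DW.
(* If all entries of [V *m D] had squared modulus at most [(K + 1)^-1], summing the bounds on the
   [M * M] entries of [V] would give [frob2 V <= K / (K + 1) < 1]. *)
pose K : R := (M * M)%:R * (2 ^+ T * frob2 W).
have K0 : 0 <= K by rewrite !mulr_ge0 ?ler0n ?frob2_ge0.
have d0 : 0 < (K + 1)^-1 by rewrite invr_gt0; lra.
exists (K + 1)^-1 => // V V1; apply: contrapT => noj.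
have small j t : csq ((V *m D) j t) <= (K + 1)^-1.
  by rewrite leNgt; apply/negP => h; apply: noj; exists j, t; exact: ltW.
have VE : V = (V *m D) *m W by rewrite -mulmxA DW mulmx1.
have ent i l : csq (V i l) <= 2 ^+ T * ((K + 1)^-1 * frob2 W).
  rewrite VE mxE; apply: (le_trans (csq_sum _)); rewrite ler_wpM2l ?exprn_ge0//.
  rewrite frob2E mulr_sumr; apply: ler_sum => t _; rewrite csqM.
  apply: ler_pM; rewrite ?csq_ge0 ?small//.
  by rewrite (bigD1 l)//= lerDl sumr_ge0// => ? _; exact: csq_ge0.
have : frob2 V <= K / (K + 1).
  rewrite frob2E; apply: (le_trans (ler_sum _ (fun i _ => ler_sum _ (fun l _ => ent i l)))).
  rewrite !sumr_const !card_ord -mulrnA -[_ *+ (M * M)]mulr_natl.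
  have -> : forall q : R, (M * M)%:R * (2 ^+ T * (q * frob2 W)) = K * q.
    by move=> q; rewrite /K; ring.
  exact: lexx.
rewrite V1 ler_pdivlMr; lra.
Qed.

End FrobeniusNorm.

(** * Layout of the channel matrices among the Gaussian coordinates *)

Section Channel.
Variables (R : realType) (M : nat).
Implicit Types (v : nat -> R).

(** Position of the real part of entry [(i, j)] of channel [k]; the imaginary part comes right after
    it. *)
Definition chidx (k i j : nat) : nat := (2 * M * M * k + 2 * (i * M + j))%N.

(** Parity determines [e]; two Euclidean divisions by [M] then recover [j], [i] and [k]. *)
Lemma chidx_inj k k' (i i' j j' : 'I_M) e e' : (e < 2)%N -> (e' < 2)%N ->
  (chidx k i j + e = chidx k' i' j' + e')%N -> [/\ k = k', i = i', j = j' & e = e'].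
Proof.
have div (a b x y : nat) : (x < M -> y < M -> a * M + x = b * M + y -> a = b /\ x = y)%N.
  move=> xM yM E; have M0 : (0 < M)%N by exact: leq_trans xM.
  have: ((a * M + x) %/ M = (b * M + y) %/ M)%N by rewrite E.
  by rewrite !divnMDl// !divn_small// !addn0 => ab; split => //; move: E; rewrite ab => /addnI.
move=> e2 e2'; rewrite /chidx => E.
have ee : e = e' by lia.
have E1 : ((M * k + i) * M + j = (M * k' + i') * M + j')%N by nia.
have [E2 jj] := div _ _ _ _ (ltn_ord j) (ltn_ord j') E1.
have E3 : (k * M + i = k' * M + i')%N by nia.
have [kk ii] := div _ _ _ _ (ltn_ord i) (ltn_ord i') E3.
by split => //; exact: val_inj.
Qed.

Lemma chan_upd_entry k k' (i i' j j' : 'I_M) e x v : (e < 2)%N ->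
  (k, i, j) <> (k', i', j') ->
  chan M k (upd (chidx k' i' j' + e) x v) i j = chan M k v i j.
Proof.
move=> e2 ne; rewrite !mxE /upd -/(chidx k i j).
have n0 : (chidx k i j == chidx k' i' j' + e)%N = false.
  apply/eqP; rewrite -[LHS]addn0 => /(chidx_inj (isT : (0 < 2)%N) e2)[kk ii jj _].
  by apply: ne; rewrite kk ii jj.
have n1 : (chidx k i j + 1 == chidx k' i' j' + e)%N = false.
  by apply/eqP => /(chidx_inj (isT : (1 < 2)%N) e2)[kk ii jj _]; apply: ne; rewrite kk ii jj.
by rewrite n0 n1.
Qed.

Lemma chan_upd k k' (i' j' : 'I_M) e x v : (e < 2)%N -> k <> k' ->
  chan M k (upd (chidx k' i' j' + e) x v) = chan M k v.
Proof.
move=> e2 ne; apply/matrixP => i j; apply: chan_upd_entry => //.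
by case.
Qed.

Lemma chidx_lt k n (i j : 'I_M) : (2 * M * M * k.+1 <= n)%N -> ((chidx k i j).+1 < n)%N.
Proof.
move=> kn; have := ltn_ord i; have := ltn_ord j; rewrite /chidx => jM iM.
have : (i * M + j < M * M)%N by nia.
nia.
Qed.

Lemma mxmeas_chan k d (T : measurableType d) (X : nat -> T -> R) :
  (forall l, measurable_fun setT (X l)) -> mxmeas (fun t => chan M k (X ^~ t)).
Proof.
move=> mX i j.
rewrite (_ : (fun t => _) = fun t => Complex (X (chidx k i j) t) (X (chidx k i j + 1)%N t)).
  by split => /=; exact: mX.
by apply/funext => t; rewrite mxE.
Qed.

End Channel.

(** * Integrating out one channel matrix, row by row *)

Section Block.
Variables (R : realType) (M T : nat).
Implicit Types (v : nat -> R) (F : (nat -> R) -> 'M[R[i]]_(M, T)).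

Definition smxmeas F := forall d (U : measurableType d) (X : nat -> U -> R),
  (forall k, measurable_fun setT (X k)) -> mxmeas (fun t => F (X ^~ t)).

Definition block_free (k : nat) F := forall v x e (i j : 'I_M), (e < 2)%N ->
  F (upd (chidx M k i j + e) x v) = F v.

(** Only column [t] of the received matrix is kept. Within it, the channel entry [(r, j)] occurs in
    row [r] alone, with coefficient [K v j t], which is large on the support of the indicator. Each
    row therefore yields one factor [(rho * delta)^-1], whence the exponent [M]. *)
Lemma block_bound k n (K S : (nat -> R) -> 'M[R[i]]_(M, T)) (rho delta : R) j t :
  (2 * M * M * k.+1 <= n)%N -> smxmeas K -> smxmeas S ->
  block_free k K -> block_free k S -> 0 < rho -> 0 < delta ->
  (gauss_expect n (fun v => ((delta <= csq (K v j t))%R%:R *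
     expR (- (rho * frob2 (chan M k v *m K v + S v))))%:E)
   <= (((rho * delta)^-1) ^+ M)%:E)%E.
Proof.
move=> kn mK mS fK fS r0 d0.
pose Y v := chan M k v *m K v + S v.
(* [f s] retains the first [s] rows; rows are removed from the last one down. *)
pose f s v : R := (delta <= csq (K v j t))%R%:R *
  \prod_(r < M | (r < s)%N) expR (- (rho * csq (Y v r t))).
have f0 s v : 0 <= f s v.
  by rewrite mulr_ge0 ?ler0n// prodr_ge0// => ? _; exact: expR_ge0.
have mf s a : smeas (fun v => (a * f s v)%:E).
  move=> d U X mX; apply/measurable_EFinP; apply: measurable_funM => //.
  apply: measurable_funM.
    apply: measurable_natr_bool.
    by apply: measurable_fun_ler; [exact: measurable_cst|apply: measurable_csq; exact: mK].
  rewrite (_ : (fun t0 => _) = fun t0 => \prod_(r <- seq.filter (fun r : 'I_M => (r < s)%N) (index_enum 'I_M))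
      expR (- (rho * csq (Y (X ^~ t0) r t)))); last first.
    by apply/funext => t0; rewrite big_filter.
  apply: measurable_prod => r _; apply: measurableT_comp => //; apply: measurableT_comp => //.
  apply: measurable_funM => //; apply: measurable_csq.
  apply: mxmeasD; last exact: mS.
  by apply: mxmeasM; [exact: mxmeas_chan | exact: mK].
(* The prefactor [a] is general because each removed row multiplies it by [(rho * delta)^-1]. *)
have key s : (s <= M)%N -> forall a, 0 <= a ->
    (gauss_expect n (fun v => (a * f s v)%:E) <= (a * ((rho * delta)^-1) ^+ s)%:E)%E.
  elim: s => [_|s IH sM] a a0.
    rewrite expr0 mulr1 -(gauss_expect_const n a0).
    apply: gauss_expect_le => v; first by rewrite lee_fin mulr_ge0.
    rewrite lee_fin ler_piMr// /f big_pred0 ?mulr1; last by move=> r; rewrite ltn0.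
    by rewrite lern1 leq_b1.
  pose r := Ordinal sM.
  pose c v := a * f s v.
  have Yupd v x e r' : (e < 2)%N -> r' != r -> forall t,
      Y (upd (chidx M k r j + e) x v) r' t = Y v r' t.
    move=> e2 rr t'; rewrite /Y !mxE fK// fS//; congr (_ + _).
    apply: eq_bigr => l _; rewrite chan_upd_entry// => -[E _].
    by rewrite E eqxx in rr.
  have cupd v x e : (e < 2)%N -> c (upd (chidx M k r j + e) x v) = c v.
    move=> e2; rewrite /c /f fK//; congr (_ * (_ * _)).
    apply: eq_bigr => r' r's; rewrite Yupd//.
    by apply: contraTneq r's => ->; rewrite ltnn.
  (* What remains of the entry [(r, t)] once the term in the channel entry [(r, j)] is set apart. *)
  pose S' v := \sum_(l < M | l != j) chan M k v r l * K v l t + S v r t.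
  have S'upd v x e : (e < 2)%N -> S' (upd (chidx M k r j + e) x v) = S' v.
    move=> e2; rewrite /S' fS//; congr (_ + _); apply: eq_bigr => l lj.
    rewrite fK// chan_upd_entry// => -[E].
    by rewrite E eqxx in lj.
  have YE v : Y v r t = K v j t * Complex (v (chidx M k r j)) (v (chidx M k r j).+1) + S' v.
    rewrite /Y mxE mxE (bigD1 j)//= -addrA; congr (_ + _).
    by rewrite mulrC mxE addn1.
  have kn' := chidx_lt r j kn.
  pose g v := (c v * expR (- (rho *
    csq (K v j t * Complex (v (chidx M k r j)) (v (chidx M k r j).+1) + S' v))))%:E.
  have gE : (fun v => (a * f s.+1 v)%:E) = g.
    apply/funext => v; rewrite /g -YE /c /f -!mulrA; congr ((_ * (_ * _))%:E).
    rewrite (bigD1 r)//= mulrC; congr (_ * _); apply: eq_bigl => r'.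
    by rewrite ltnS andbC [RHS]ltn_neqAle.
  rewrite gE.
  have mg : smeas g by rewrite -gE; exact: mf.
  have c0 v : 0 <= c v by rewrite mulr_ge0.
  have cK v : c v != 0 -> delta <= csq (K v j t).
    by apply: contraNT => /negbTE h; rewrite /c /f h mul0r mulr0.
  have two_upd (U : Type) (h : (nat -> R) -> U) : (forall v x e, (e < 2)%N ->
      h (upd (chidx M k r j + e) x v) = h v) ->
      (forall v x, h (upd (chidx M k r j) x v) = h v) /\
      (forall v x, h (upd (chidx M k r j).+1 x v) = h v).
    by move=> hu; split => v x; [rewrite -[chidx _ _ _ _]addn0|rewrite -addn1]; exact: hu.
  have [c1 c2] := two_upd _ c cupd.
  have Kupd v x e : (e < 2)%N -> K (upd (chidx M k r j + e) x v) j t = K v j t.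
    by move=> e2; rewrite fK.
  have [K1 K2] := two_upd _ (fun v => K v j t) Kupd.
  have [S1 S2] := two_upd _ S' S'upd.
  apply: (le_trans (@gauss_expect_row _ n (chidx M k r j) rho delta c (fun v => K v j t) S'
    kn' r0 d0 c0 cK c1 c2 K1 K2 S1 S2 mg)).
  rewrite (_ : (fun v => _) = fun v => ((a / (rho * delta)) * f s v)%:E); last first.
    by apply/funext => v; rewrite /c mulrAC.
  apply: (le_trans (IH (ltnW sM) _ _)).
    by rewrite divr_ge0// mulr_ge0 ?ltW.
  by rewrite exprS mulrA.
rewrite -[X in X%:E]mul1r.
apply: le_trans (key M (leqnn M) 1 ler01).
apply: gauss_expect_le => v; first by rewrite lee_fin mulr_ge0 ?ler0n ?expR_ge0.
rewrite lee_fin mul1r /f ler_wpM2l ?ler0n//.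
rewrite (eq_bigl xpredT) => [|r]; last by rewrite ltn_ord.
rewrite -expR_sum ler_expR sumrN lerN2 -mulr_sumr ler_pM2l// frob2E.
apply: ler_sum => r _; rewrite (bigD1 t)//= lerDl sumr_ge0// => ? _; exact: csq_ge0.
Qed.

End Block.

(** * Bound obtained from one transmitter with distinct codewords *)

Section OneSide.
Variables (R : realType) (M T : nat).
Implicit Types (v : nat -> R).

Definition branch (c : R) (ka kb : nat) (D : 'M[R[i]]_(M, T)) v : 'M[R[i]]_(M, T) :=
  rC (Num.sqrt c) *: (chan M ka v *m precoder (chan M kb v) *m D).

Lemma smxmeas_precoder (c : R) kb (D : 'M[R[i]]_(M, T)) :
  smxmeas (fun v => rC (Num.sqrt c) *: (precoder (chan M kb v) *m D)).
Proof.
move=> d U X mX; apply: mxmeasZ; first exact: cmeas_cst.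
apply: mxmeasM; last exact: mxmeas_cst.
exact/mxmeas_precoder/mxmeas_chan.
Qed.

Lemma branchE c ka kb (D : 'M[R[i]]_(M, T)) v : branch c ka kb D v =
  chan M ka v *m (rC (Num.sqrt c) *: (precoder (chan M kb v) *m D)).
Proof. by rewrite /branch -mulmxA scalemxAr. Qed.

Lemma smxmeas_branch c ka kb (D : 'M[R[i]]_(M, T)) : smxmeas (branch c ka kb D).
Proof.
move=> d U X mX; apply: mxmeasZ; first exact: cmeas_cst.
apply: mxmeasM; last exact: mxmeas_cst.
apply: mxmeasM; first exact: mxmeas_chan.
exact/mxmeas_precoder/mxmeas_chan.
Qed.

Lemma block_free_branch k c ka kb (D : 'M[R[i]]_(M, T)) :
  ka <> k -> kb <> k -> block_free k (branch c ka kb D).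
Proof. by move=> ak bk v x e i j e2; rewrite /branch !chan_upd. Qed.

Lemma smeas_block k (K S : (nat -> R) -> 'M[R[i]]_(M, T)) (rho delta : R) j t :
  smxmeas K -> smxmeas S ->
  smeas (fun v => ((delta <= csq (K v j t))%R%:R *
     expR (- (rho * frob2 (chan M k v *m K v + S v))))%:E).
Proof.
move=> mK mS d U X mX; apply/measurable_EFinP; apply: measurable_funM.
  apply: measurable_natr_bool.
  by apply: measurable_fun_ler; [exact: measurable_cst|apply: measurable_csq; exact: mK].
apply: measurableT_comp => //; apply: measurableT_comp => //.
apply: measurable_funM => //; apply: measurable_sum => i; apply: measurable_sum => l.
apply: (measurable_csq (F := fun u => (chan M k (X ^~ u) *m K (X ^~ u) + S (X ^~ u)) i l)).
apply: mxmeasD; last exact: mS.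
by apply: mxmeasM; [exact: mxmeas_chan | exact: mK].
Qed.

(** The other transmitter enters only through [S], which is arbitrary as long as it does not involve
    block [ka]. The integrand is dominated by a sum over the possible positions of a large entry,
    plus the indicator of a null event. *)
Lemma branch_bound ka kb (c : R) (D : 'M[R[i]]_(M, T)) (S : (nat -> R) -> 'M[R[i]]_(M, T)) :
  (0 < M)%N -> (ka < 4)%N -> (kb < 4)%N -> ka <> kb -> 0 < c -> \rank D = M ->
  smxmeas S -> block_free ka S ->
  exists2 C : R, 0 < C & forall rho, 0 < rho ->
    (gauss_expect (8 * M * M) (fun v =>
       (expR (- (rho * frob2 (branch c ka kb D v + S v))))%:E)
     <= (C * rho^-1 ^+ M)%:E)%E.
Proof.
move=> M0 ka4 kb4 kab c0 rD mS fS.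
have [delta d0 low] := row_free_entry_lower rD.
have cd0 : 0 < c * delta by rewrite mulr_gt0.
(* One term per position [(j, t)], with lower bound [c * delta] because of the scaling by [sqrt c];
   adding 1 makes positivity of the constant immediate. *)
pose Q : R := (M * T)%:R * (c * delta)^-1 ^+ M.
exists (Q + 1) => [|rho r0].
  by rewrite ltr_wpDl// mulr_ge0 ?ler0n ?exprn_ge0// invr_ge0 ltW.
pose K v := rC (Num.sqrt c) *: (precoder (chan M kb v) *m D).
have mK : smxmeas K by exact: smxmeas_precoder.
have fK : block_free ka K.
  by move=> v x e i j e2; rewrite /K chan_upd//; exact/nesym.
pose G v := expR (- (rho * frob2 (chan M ka v *m K v + S v))).
pose f (p : 'I_M * 'I_T) v : \bar R :=
  ((c * delta <= csq (K v p.1 p.2))%R%:R * G v)%:E.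
(* The null event [H = 0] is enlarged to the vanishing of the real part of the top-left entry, a
   condition on one coordinate. *)
pose z0 := chidx M kb (Ordinal M0) (Ordinal M0).
pose z v : \bar R := ((v z0 == 0)%:R)%:E.
have f0 p v : (0 <= f p v)%E by rewrite lee_fin mulr_ge0 ?ler0n ?expR_ge0.
have z0' v : (0 <= z v)%E by rewrite lee_fin ler0n.
have mf p : smeas (f p) by exact: smeas_block.
have mz : smeas z by exact: smeas_eq0.
have kn k : (k < 4)%N -> (2 * M * M * k.+1 <= 8 * M * M)%N by nia.
apply: (@le_trans _ _ (gauss_expect (8 * M * M)
    (fun v => \sum_(p <- index_enum ('I_M * 'I_T)%type) f p v + z v))%E).
  apply: gauss_expect_le => v; first by rewrite lee_fin expR_ge0.
  rewrite branchE -/(K v) -/(G v).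
  (* On the null event the exponential is at most 1; off it the precoder has norm 1, so some
     indicator [f (j, t)] is active. *)
  have [vz|vz] := eqVneq (v z0) 0.
    apply: (@le_trans _ _ (z v)); last by rewrite leeDr ?sume_ge0.
    rewrite /z vz eqxx lee_fin -expR0 ler_expR oppr_le0 mulr_ge0 ?(ltW r0)//.
    exact: frob2_ge0.
  have H0 : chan M kb v != 0.
    apply: contra vz => /eqP/matrixP/(_ (Ordinal M0) (Ordinal M0)).
    by rewrite !mxE => -[-> _].
  have [j [t jt]] := low _ (frob2_precoder H0).
  apply: (@le_trans _ _ (f (j, t) v)).
    rewrite lee_fin /= /K mxE csqM csq_rC sqr_sqrtr ?(ltW c0)// ler_pM2l// jt.
    by rewrite mul1r.
  rewrite -[leLHS]adde0; apply: leeD => //.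
  rewrite (bigD1 (j, t))//= -[leLHS]adde0; apply: leeD => //; exact: sume_ge0.
rewrite gauss_expectD//; last 2 first.
- by move=> d U X mX; apply: emeasurable_sum => p; exact: mf.
- by move=> v; exact: sume_ge0.
rewrite gauss_expect_eq0 ?adde0; last exact/ltnW/chidx_lt/kn.
rewrite gauss_expect_sum//.
have bnd p : (gauss_expect (8 * M * M) (f p) <= ((rho * (c * delta))^-1 ^+ M)%:E)%E.
  by apply: block_bound => //; exact: kn.
apply: (le_trans (lee_sum _ (fun p _ => bnd p))).
rewrite sumEFin lee_fin sumr_const card_prod !card_ord -[_ *+ _]mulr_natl.
rewrite invfM exprMn [rho^-1 ^+ M * _]mulrC mulrA -/Q ler_wpM2r ?lerDl//.
by rewrite exprn_ge0// invr_ge0 ltW.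
Qed.

End OneSide.

Theorem theorem1 (R : realType) (M T : nat) (hM : (1 <= M)%N) (hT : (M <= T)%N)
  (c1 c2 s2 : R) (hc1 : 0 < c1) (hc2 : 0 < c2) (hs2 : 0 < s2)
  (C1 C2 : seq 'M[R[i]]_(M, T))
  (hC1 : forall A A', A \in C1 -> A' \in C1 -> A != A' -> \rank (A - A') = M)
  (hC2 : forall B B', B \in C2 -> B' \in C2 -> B != B' -> \rank (B - B') = M)
  (A A' B B' : 'M[R[i]]_(M, T))
  (hA : A \in C1) (hA' : A' \in C1) (hB : B \in C2) (hB' : B' \in C2)
  (hne : (A, B) != (A', B')) :
  exists c : R, 0 < c /\ exists P0 : R, forall P : R, P0 < P ->
    (pep c1 c2 s2 P A A' B B' <= (c * P ^- M)%:E)%E.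
Proof.
pose YA := branch c1 0 1 (A - A'); pose YB := branch c2 2 3 (B - B').
have [C C0 bnd] : exists2 C : R, 0 < C & forall rho, 0 < rho ->
    (gauss_expect (8 * M * M) (fun v => (expR (- (rho * frob2 (YA v + YB v))))%:E)
     <= (C * rho^-1 ^+ M)%:E)%E.
  (* If [A] and [A'] differ, block 0 is integrated out with [YB] as the shift; otherwise [B] and
     [B'] differ and the roles are exchanged, using block 2. *)
  have [AA|AA] := eqVneq A A'; last first.
    have fB : block_free 0 YB by exact: block_free_branch.
    exact: (branch_bound (ka := 0) (kb := 1) hM isT isT (fun e => ltac:(discriminate e))
      hc1 (hC1 _ _ hA hA' AA)
      (smxmeas_branch c2 2 3 (B - B')) fB).
  have BB : B != B' by apply: contraNneq hne => ->; rewrite AA.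
  have fA : block_free 2 YA by exact: block_free_branch.
  have [C C0 bnd] := branch_bound (ka := 2) (kb := 3) hM isT isT
    (fun e => ltac:(discriminate e)) hc2 (hC2 _ _ hB hB' BB)
    (smxmeas_branch c1 0 1 (A - A')) fA.
  exists C; first exact: C0.
  move=> rho r0.
  have -> : (fun v => (expR (- (rho * frob2 (YA v + YB v))))%:E) =
      (fun v => (expR (- (rho * frob2 (YB v + YA v))))%:E).
    by apply/funext => v; rewrite [YA v + _]addrC.
  exact: bnd.
(* With [rho = P / (4 * s2)], the power [rho^-1 ^+ M] equals [(4 * s2) ^+ M * P ^- M]. The estimate
   is valid for every positive [P], hence the threshold 0 below. *)
exists (C * (4 * s2) ^+ M); split; first by rewrite mulr_gt0// exprn_gt0// mulr_gt0.
exists 0 => P P0.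
have r0 : 0 < P / (4 * s2) by rewrite divr_gt0// mulr_gt0.
have E : C * (4 * s2) ^+ M * P ^- M = C * (P / (4 * s2))^-1 ^+ M.
  by rewrite invf_div expr_div_n mulrA.
rewrite E; apply: le_trans (bnd _ r0).
apply: gauss_expect_le => v.
  by rewrite /Qfun mule_ge0 ?lee_fin ?invr_ge0 ?sqrtr_ge0// integral_ge0.
apply: (le_trans (Qfun_le (sqrtr_ge0 _))).
rewrite lee_fin ler_expR sqr_sqrtr; last first.
  by rewrite divr_ge0 ?mulr_ge0 ?frob2_ge0// ltW.
set F := frob2 _; rewrite le_eqVlt; apply/orP; left; apply/eqP; field.
by rewrite gt_eqF.
Qed.
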